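(* Let $\delta>0$, put $C_1=(L_1+L_2)^2/\mu$ and $C_2=1/(8C_1)$, and for $k\ge 0$ let $$\lambda_k=(k+1)^{-1/4},\quad \eta_k=C_1(k+1)^{1/4},\quad \theta_k=C_2(k+1)^{-1/4},\quad N_k=\lceil (k+1)^{1+\delta}\rceil .$$ Let $\{x_k\}_{k\ge 0}$ be the sequence generated by the RVC-IPG iteration (defined in the context) with these parameters, and suppose that the problem assumptions and the stochastic error assumption stated in the context hold. Then: (i) For $T\ge1$, $\displaystyle\min_{0\le k\le T-1}\mathbb{E}\big[\|H(x_k,\eta_k)\|^2\big]=\mathcal{O}\big(1/\sqrt T\big)$; that is, there is a constant $K>0$ independent of $T$ such that the left-hand side is at most $K/\sqrt T$ for every integer $T\ge 1$. (ii) The total number of stochastic oracle calls needed to compute an $\epsilon$-solution, i.e. to achieve $\min_k\mathbb{E}[\|H(x_k,\eta_k)\|^2]\le\epsilon$, is $\mathcal{O}(1/\epsilon^{4+2\delta})$; that is, there is a constant $K'>0$ independent of $\epsilon$ such that for every $\epsilon\in(0,1]$ there is an integer $T\ge1$ with $\min_{0\le k\le T-1}\mathbb{E}[\|H(x_k,\eta_k)\|^2]\le\epsilon$ and $\sum_{k=0}^{T-1}N_k\le K'\epsilon^{-(4+2\delta)}$.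
   Context: Setting. $X\subseteq\mathbb{R}^n$ is a nonempty closed convex set, $\|\cdot\|$ is the Euclidean norm, and $\mathbf{P}_X$ is the Euclidean projection onto $X$. $\xi:\Omega\to\mathbb{R}^d$ is a random vector on a probability space $(\Omega,\mathcal{F},\mathbb{P})$, $G:\mathbb{R}^n\times\mathbb{R}^d\to\mathbb{R}^n$ is measurable, and $F(x)=\mathbb{E}[G(x,\xi)]$ is well defined for every $x\in\mathbb{R}^n$. The stochastic inverse variational inequality (SIVI) is to find $x$ with $F(x)\in X$ and $\langle y-F(x),x\rangle\ge 0$ for all $y\in X$; its solution set is $$S=\{x\in\mathbb{R}^n:\ F(x)\in X,\ \langle y-F(x),x\rangle\ge 0\ \ \forall y\in X\}.$$ Problem assumptions. (i) $F:\mathbb{R}^n\to\mathbb{R}^n$ is monotone ($\langle F(x)-F(y),x-y\rangle\ge0$ for all $x,y$) and $L_1$-Lipschitz continuous; (ii) $\Phi:\mathbb{R}^n\to\mathbb{R}^n$ is $\mu$-strongly monotone ($\langle \Phi(x)-\Phi(y),x-y\rangle\ge\mu\|x-y\|^2$ for all $x,y$, with $\mu>0$) and $L_2$-Lipschitz continuous; (iii) $S\neq\emptyset$. Residual map. For $\eta>0$, $H(x,\eta)=F(x)-\mathbf{P}_X(F(x)-\eta x)$. RVC-IPG iteration. Given $x_0\in\mathbb{R}^n$, positive parameters $\eta_k,\theta_k,\lambda_k$, positive integers $N_k$, and random samples $\xi_{j,k}$ of $\xi$ ($1\le j\le N_k$, $k\ge0$), set $\hat F_k=\frac1{N_k}\sum_{j=1}^{N_k}G(x_k,\xi_{j,k})+\lambda_k\Phi(x_k)$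 and $$z_k=\mathbf{P}_X[\hat F_k-\eta_kx_k],\qquad x_{k+1}=x_k-\theta_k(\hat F_k-z_k),\qquad k\ge 0.$$ Each evaluation of $G(x_k,\xi_{j,k})$ is one stochastic oracle call, so iteration $k$ uses $N_k$ calls. Stochastic error assumption. Let $\mathcal{F}_k=\sigma\{x_0,\xi_{j,s}:0\le s\le k-1,\ 1\le j\le N_s\}$ and $\bar w_{k,N_k}=\frac1{N_k}\sum_{j=1}^{N_k}(G(x_k,\xi_{j,k})-F(x_k))$. There exists $\nu>0$ such that for all $k$, almost surely, $\mathbb{E}[\bar w_{k,N_k}\mid\mathcal{F}_k]=0$ and $\mathbb{E}[\|\bar w_{k,N_k}\|^2\mid\mathcal{F}_k]\le \nu^2/N_k$. *)

(* Defs.v *)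
From HB Require Import structures.
From mathcomp Require Import all_boot all_order all_algebra.
From mathcomp Require Import all_classical all_reals all_analysis.

Set Implicit Arguments.
Unset Strict Implicit.
Unset Printing Implicit Defensive.

Import Order.TTheory GRing.Theory Num.Theory.
Import numFieldTopology.Exports numFieldNormedType.Exports.

Local Open Scope classical_set_scope.
Local Open Scope ring_scope.

(* R^n with its Borel sigma-algebra. A product of two such types carries the
   library's product sigma-algebra, which is the Borel sigma-algebra of the
   product space because R^n is second countable. *)
Notation borel_rV R n := (g_sigma_algebraType (@open 'rV[R]_n)).

Section euclidean.
Context {R : realType} {n : nat}.
Implicit Types (u v x y : 'rV[R]_n) (X : set 'rV[R]_n) (F : 'rV[R]_n -> 'rV[R]_n).

Definition dot u v : R := \sum_(i < n) u 0 i * v 0 i.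

(* The norm `|u| of the library on 'rV[R]_n is the sup norm (it induces the same
   topology), hence a separate Euclidean norm. *)
Definition enorm u : R := Num.sqrt (dot u u).

Definition is_eproj X v p := X p /\ forall y, X y -> enorm (v - p) <= enorm (v - y).

(* The default value 0 is irrelevant when X is nonempty, closed and convex. *)
Definition eproj X v : 'rV[R]_n := xget 0 [set p | is_eproj X v p].

Definition monotone_map F := forall x y, 0 <= dot (F x - F y) (x - y).

Definition strongly_monotone_map (mu : R) F :=
  forall x y, mu * enorm (x - y) ^+ 2 <= dot (F x - F y) (x - y).

Definition lipschitz_map (L : R) F :=
  forall x y, enorm (F x - F y) <= L * enorm (x - y).

Definition sivi_solutions X F : set 'rV[R]_n :=
  [set x | X (F x) /\ forall y, X y -> 0 <= dot (y - F x) x].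

Definition residual X F x (eta : R) : 'rV[R]_n := F x - eproj X (F x - eta *: x).

End euclidean.

Section conditional_expectation.
Context {dT : measure_display} {Omega : measurableType dT} {R : realType}.
Variable P : probability Omega R.

(* Y is a version of the conditional expectation of the integrable random
   variable Z given the sub-sigma-algebra S. *)
Definition is_condexp (S : set (set Omega)) (Z Y : Omega -> R) : Prop :=
  [/\ P.-integrable setT (EFin \o Z),
      P.-integrable setT (EFin \o Y),
      forall B : set R, measurable B -> S (Y @^-1` B) &
      forall A, S A ->
        (\int[P]_(w in A) (Y w)%:E = \int[P]_(w in A) (Z w)%:E)%E].

Definition is_condexp_rV n (S : set (set Omega)) (Z Y : Omega -> 'rV[R]_n) : Prop :=
  forall i : 'I_n, is_condexp S (fun w => Z w 0 i) (fun w => Y w 0 i).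

End conditional_expectation.

Section rvc_ipg.
Context {dT : measure_display} {Omega : measurableType dT} {R : realType}.
Variable P : probability Omega R.
Context {n d : nat}.
Variable G : 'rV[R]_n -> 'rV[R]_d -> 'rV[R]_n.

(* F(x) = E[G(x, xi)], the expectation being taken coordinatewise. *)
Definition mean_map (xi : Omega -> 'rV[R]_d) (x : 'rV[R]_n) : 'rV[R]_n :=
  \row_(i < n) fine ('E_P[fun w => (G x (xi w) 0 i)%R])%E.

Variables (X : set 'rV[R]_n) (Phi : 'rV[R]_n -> 'rV[R]_n).
Variables (lambda eta theta : nat -> R) (N : nat -> nat).
Variable x0 : 'rV[R]_n.
(* xis j k is the sample xi_{j+1,k}: the samples of iteration k are indexed by
   0 <= j < N k. *)
Variable xis : nat -> nat -> Omega -> 'rV[R]_d.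

Definition Fhat (k : nat) (w : Omega) (x : 'rV[R]_n) : 'rV[R]_n :=
  (N k)%:R^-1 *: (\sum_(j < N k) G x (xis j k w)) + lambda k *: Phi x.

Fixpoint rvc_ipg (k : nat) (w : Omega) : 'rV[R]_n :=
  if k is k'.+1 then
    let x := rvc_ipg k' w in
    let z := eproj X (Fhat k' w x - eta k' *: x) in
    x - theta k' *: (Fhat k' w x - z)
  else x0.

Definition sample_error (F : 'rV[R]_n -> 'rV[R]_n) (k : nat) (w : Omega) : 'rV[R]_n :=
  (N k)%:R^-1 *: \sum_(j < N k) (G (rvc_ipg k w) (xis j k w) - F (rvc_ipg k w)).

(* F_k = sigma(x_0, xi_{j,s} : s < k, j <= N_s); x_0 is deterministic, so the first
   family of generators contributes only set0 and setT. *)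
Definition history (k : nat) : set (set Omega) :=
  <<s preimage_set_system setT (cst x0) (@measurable _ (borel_rV R n)) `|`
      [set A | exists s j, [/\ (s < k)%N, (j < N s)%N &
         preimage_set_system setT (xis j s) (@measurable _ (borel_rV R d)) A]] >>.

Definition stochastic_error_assumption (F : 'rV[R]_n -> 'rV[R]_n) : Prop :=
  exists2 nu : R, 0 < nu & forall k : nat,
    (exists2 Y : Omega -> 'rV[R]_n,
       is_condexp_rV P (history k) (sample_error F k) Y &
       {ae P, forall w, Y w = 0}) /\
    (exists2 Y : Omega -> R,
       is_condexp P (history k) (fun w => enorm (sample_error F k w) ^+ 2) Y &
       {ae P, forall w, Y w <= nu ^+ 2 / (N k)%:R}).

End rvc_ipg.

(* min_{0 <= k <= T-1} E[||H(x_k, eta_k)||^2] for a random sequence x; the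
   expectations, hence the minimum, are extended reals. *)
Definition min_residual {dT : measure_display} {Omega : measurableType dT}
    {R : realType} (P : probability Omega R) {n : nat} (X : set 'rV[R]_n)
    (F : 'rV[R]_n -> 'rV[R]_n) (eta : nat -> R) (x : nat -> Omega -> 'rV[R]_n)
    (T : nat) : \bar R :=
  (\big[Order.min/+oo]_(k < T)
     'E_P[fun w => (enorm (residual X F (x k w) (eta k)) ^+ 2)%R])%E.

(* Main.v *)
Require Import Defs.
From HB Require Import structures.
From mathcomp Require Import all_boot all_order all_algebra.
From mathcomp Require Import all_classical all_reals all_analysis.
From mathcomp Require Import measurable_realfun ring lra.

Import Order.TTheory GRing.Theory Num.Theory.
Import numFieldTopology.Exports numFieldNormedType.Exports.
Import HBNNSimple.

Local Open Scope classical_set_scope.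
Local Open Scope ring_scope.

Set Implicit Arguments.
Unset Strict Implicit.
Unset Printing Implicit Defensive.

(** The proof compares the iterates not with a solution of the problem but with
    the moving solutions of the regularized problems. For [la > 0] the map
    [F + la *: Phi] is strongly monotone with modulus [la * mu] and Lipschitz with
    constant [L1 + L2] as long as [la <= 1], so its inverse variational inequality
    has a solution: the projection step of the method is a contraction
    ([sivi_solution_exists]). These solutions are bounded and depend on [la] in a
    Lipschitz way relative to [la] ([regularized_solution_dist]), so with
    [lambda k] of order [k `^ (- 1 / 4)] consecutive solutions differ by [O(1 / k)].

    The parameters are tuned so that [eta k = C1 / lambda k] and
    [theta k = (8 * eta k)^-1]. Firm nonexpansiveness of the projection then gives
    a one-step inequality ([ipg_step_le]) which, once the move of the regularized
    solution and the bias of the residual are absorbed, reads ([one_step])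

      [E k.+1 + b * r k * H k <= (1 - c * r k) * E k + C * (s k + r k ^+ 2)]

    with [r k] the inverse square root of [k.+1], [E k] the squared distance from
    the iterate to the regularized solution, [H k] the squared residual and [s k]
    the squared sampling error. This inequality holds pointwise on the probability
    space. The cross term between the sampling error and [E k] is paid for by
    Young's inequality and strong monotonicity: the batches are so large that the
    mean of [s k] is at most [nu ^+ 2 * r k ^+ 2], the order of the other errors.

    The contraction keeps the mean of [E k] bounded ([majorant_mean]). Summing the
    inequality over the indices from [T./2] to [T], where the sum of [r k] is of
    order [sqrt T] and the sum of [r k ^+ 2] is bounded, some [H k] has mean
    [O(1 / sqrt T)] ([min_mean_rate]). The expectations of [H k] are handled
    through simple functions below [H k] ([sum_mean_gt]), which avoids proving that
    the iterates are measurable. The oracle complexity follows by taking [T] of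
    order [eps ^- 2] and bounding the sum of the batch sizes by a multiple of
    [T `^ (2 + delta)] ([oracle_calls_le]). *)

(** * Euclidean geometry and a fixed point theorem *)

Section euclidean_geometry.
Context {R : realType} {n : nat}.
Implicit Types (u v w x y p q : 'rV[R]_n) (X : set 'rV[R]_n).

Lemma dotC u v : dot u v = dot v u.
Proof. by apply: eq_bigr => i _; rewrite mulrC. Qed.

Lemma dotDl u v w : dot (u + v) w = dot u w + dot v w.
Proof. by rewrite /dot -big_split; apply: eq_bigr => i _; rewrite mxE mulrDl. Qed.

Lemma dotZl (a : R) u v : dot (a *: u) v = a * dot u v.
Proof. by rewrite /dot mulr_sumr; apply: eq_bigr => i _; rewrite mxE mulrA. Qed.

Lemma dotNl u v : dot (- u) v = - dot u v.
Proof. by rewrite -scaleN1r dotZl mulN1r. Qed.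

Lemma dotBl u v w : dot (u - v) w = dot u w - dot v w.
Proof. by rewrite dotDl dotNl. Qed.

Lemma dotDr u v w : dot w (u + v) = dot w u + dot w v.
Proof. by rewrite !(dotC w) dotDl. Qed.

Lemma dotZr (a : R) u v : dot v (a *: u) = a * dot v u.
Proof. by rewrite !(dotC v) dotZl. Qed.

Lemma dotNr u v : dot v (- u) = - dot v u.
Proof. by rewrite !(dotC v) dotNl. Qed.

Lemma dotBr u v w : dot w (u - v) = dot w u - dot w v.
Proof. by rewrite !(dotC w) dotBl. Qed.

Lemma dot0l v : dot 0 v = 0.
Proof. by rewrite -(scale0r 0) dotZl mul0r. Qed.

Definition dotE := (dotDl, dotDr, dotNl, dotNr, dotZl, dotZr).

Lemma dot_ge0 u : 0 <= dot u u.
Proof. by apply: sumr_ge0 => i _; rewrite -expr2 sqr_ge0. Qed.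

Lemma dot_eq0 u : (dot u u == 0) = (u == 0).
Proof.
apply/eqP/eqP => [|->]; last exact: dot0l.
move=> /psumr_eq0P u0; apply/rowP => i; rewrite mxE.
have /eqP : u 0 i * u 0 i = 0 by apply: u0 => // j _; rewrite -expr2 sqr_ge0.
by rewrite mulf_eq0 orbb => /eqP.
Qed.

Lemma enorm_ge0 u : 0 <= enorm u.
Proof. exact: sqrtr_ge0. Qed.

Lemma enorm_sqr u : enorm u ^+ 2 = dot u u.
Proof. by rewrite sqr_sqrtr// dot_ge0. Qed.

Lemma ler_enorm u v : (enorm u <= enorm v) = (dot u u <= dot v v).
Proof. by rewrite ler_sqrt ?dot_ge0. Qed.

(** Young's inequality with a free weight [t]: expand the square norm of
    [t *: u - v] and divide by [t]. *)
Lemma young_dot (t : R) u v : 0 < t ->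
  2 * dot u v <= t * dot u u + t^-1 * dot v v.
Proof.
move=> t0; have := dot_ge0 (t *: u - v); rewrite !dotE (dotC v u) => h.
have -> : t * dot u u + t^-1 * dot v v = t^-1 * (t * (t * dot u u) + dot v v).
  by field; rewrite gt_eqF.
by rewrite -ler_pdivrMl ?invr_gt0// invrK; lra.
Qed.

Lemma young_dotN (t : R) u v : 0 < t ->
  - (2 * dot u v) <= t * dot u u + t^-1 * dot v v.
Proof.
move=> t0; have := young_dot u (- v) t0.
by rewrite !dotNr dotNl opprK mulrN.
Qed.

Lemma dot_subZ (t : R) u v :
  dot (u - t *: v) (u - t *: v) = dot u u - 2 * t * dot u v + t ^+ 2 * dot v v.
Proof. by rewrite !dotE (dotC v u); ring. Qed.

Lemma dotD_weighted (t : R) u v : 0 < t ->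
  dot (u + v) (u + v) <= (1 + t) * dot u u + (1 + t^-1) * dot v v.
Proof. by move=> t0; have := young_dot u v t0; rewrite !dotE (dotC v u); lra. Qed.

Lemma dotB_le u v : dot (u - v) (u - v) <= 2 * dot u u + 2 * dot v v.
Proof. by have := dot_ge0 (u + v); rewrite !dotE (dotC v u); lra. Qed.

Lemma dotD_le u v : dot (u + v) (u + v) <= 2 * dot u u + 2 * dot v v.
Proof. by have := dot_ge0 (u - v); rewrite !dotE (dotC v u); lra. Qed.

Lemma cauchy_schwarz u v : dot u v <= enorm u * enorm v.
Proof.
have [->|un0] := eqVneq u 0; first by rewrite dot0l mulr_ge0 ?enorm_ge0.
have [->|vn0] := eqVneq v 0; first by rewrite dotC dot0l mulr_ge0 ?enorm_ge0.
(* the weight that makes both terms of Young's bound equal *)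
have nu : 0 < enorm u by rewrite sqrtr_gt0 lt_def dot_ge0 dot_eq0 un0.
have nv : 0 < enorm v by rewrite sqrtr_gt0 lt_def dot_ge0 dot_eq0 vn0.
have := @young_dot (enorm v / enorm u) u v (divr_gt0 nv nu).
rewrite -!enorm_sqr.
have -> : enorm v / enorm u * enorm u ^+ 2 + (enorm v / enorm u)^-1 * enorm v ^+ 2
  = 2 * (enorm u * enorm v) by field; rewrite !gt_eqF.
lra.
Qed.

Lemma enormD u v : enorm (u + v) <= enorm u + enorm v.
Proof.
rewrite -ler_sqr ?nnegrE ?addr_ge0 ?enorm_ge0// enorm_sqr !dotE (dotC v u).
have := cauchy_schwarz u v; have := enorm_sqr u; have := enorm_sqr v; nra.
Qed.

Lemma enormZ (a : R) u : enorm (a *: u) = `|a| * enorm u.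
Proof. by rewrite /enorm dotZl dotZr mulrA -expr2 sqrtrM ?sqr_ge0// sqrtr_sqr. Qed.

(** Comparison with the sup norm, which defines the topology and the bounded
    sets of the space. *)
Lemma sup_norm_le_enorm u : `|u| <= enorm u.
Proof.
rewrite [leLHS]/Num.norm /= mx_normrE; apply: bigmax_le => [|[i j] _].
  exact: enorm_ge0.
rewrite -[leLHS]sqrtr_sqr ler_sqrt ?dot_ge0//= ord1 /dot (bigD1 j)//= expr2.
by rewrite lerDl sumr_ge0// => k _; rewrite -expr2 sqr_ge0.
Qed.

Lemma enorm_le_sup_norm u : enorm u <= Num.sqrt n%:R * `|u|.
Proof.
rewrite -[`|u|]ger0_norm// -sqrtr_sqr -sqrtrM// ler_sqrt; last first.
  by rewrite mulr_ge0// sqr_ge0.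
rewrite mulr_natl -[X in _ *+ X]card_ord -sumr_const; apply: ler_sum => i _.
rewrite -expr2 -real_normK ?num_real// lerXn2r ?nnegrE//.
by rewrite [leRHS]/Num.norm /= mx_normrE; apply/bigmax_geP; right; exists (0, i).
Qed.

Lemma enorm_continuous : continuous (@enorm R n).
Proof.
move=> x; apply: (@continuous_comp _ _ _ (fun u => dot u u) Num.sqrt); last first.
  exact: sqrt_continuous.
apply: continuous_big => [|i _ y]; first exact: add_continuous.
by apply: continuousM; apply: (@coord_continuous R 1 n 0 i).
Qed.

(** Banach's theorem through compactness: the displacement [enorm (T x - x)]
    attains its minimum on the sublevel set through the origin, which is bounded
    because [T] contracts, and [T] strictly decreases a positive displacement. *)
Lemma contraction_fixed_point (rho : R) (T : 'rV[R]_n -> 'rV[R]_n) : rho < 1 ->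
  (forall x y, dot (T x - T y) (T x - T y) <= rho * dot (x - y) (x - y)) ->
  exists p, T p = p.
Proof.
move=> rho1 Tle; pose k := Num.sqrt (Num.max 0 rho).
have k0 : 0 <= Num.max 0 rho by rewrite le_max lexx.
have k1 : k < 1 by rewrite -[ltRHS]sqrtr1 ltr_sqrt// gt_max ltr01.
have Tk x y : enorm (T x - T y) <= k * enorm (x - y).
  rewrite -sqrtrM// ler_sqrt ?mulr_ge0 ?dot_ge0//.
  by rewrite (le_trans (Tle x y))// ler_wpM2r ?dot_ge0// le_max lexx orbT.
have Tcont : continuous T.
  move=> x; apply/(@cvgrPdist_lt _ _ _ (nbhs x) (nbhs_filter x)) => e e0.
  have c0 : 0 < Num.sqrt n%:R + 1 :> R by rewrite ltr_wpDl ?sqrtr_ge0.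
  apply: filterS (nbhsx_ballx x _ (divr_gt0 e0 c0)) => y.
  rewrite -ball_normE /= => xy; apply: le_lt_trans (sup_norm_le_enorm _) _.
  apply: le_lt_trans (Tk _ _) _.
  apply: (@le_lt_trans _ _ ((Num.sqrt n%:R + 1) * `|x - y|)).
    have := enorm_le_sup_norm (x - y); have := enorm_ge0 (x - y).
    have := normr_ge0 (x - y); nra.
  by rewrite mulrC -ltr_pdivlMr.
pose g x := enorm (T x - x).
have gcont : continuous g.
  move=> x; apply: (@continuous_comp _ _ _ (fun y => T y - y) (@enorm R n)).
    by apply: continuousB; [exact: Tcont|exact: cvg_id].
  exact: enorm_continuous.
pose A := [set x | g x <= g 0].
have Acl : closed A.
  apply: (@preimage_closed _ _ g [set r | r <= g 0]); last exact: closed_le.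
  by move=> ? _; exact: gcont.
have Abnd : bounded_set A.
  exists ((g 0 + enorm (T 0)) / (1 - k)); split; first exact: num_real.
  move=> M ltM x Ax; apply: le_trans (ltW ltM).
  apply: le_trans (sup_norm_le_enorm _) _.
  rewrite ler_pdivlMr ?subr_gt0// mulrBr mulr1 lerBlDr.
  have {1}-> : x = (x - T x) + ((T x - T 0) + T 0) by rewrite subrK subrK.
  apply: le_trans (enormD _ _) _; rewrite -[leRHS]addrA lerD//.
    rewrite -opprB -scaleN1r enormZ normrN1 mul1r; exact: Ax.
  apply: le_trans (enormD _ _) _; rewrite addrC lerD//.
  by rewrite mulrC -[in leRHS](subr0 x).
have [p] := EVT_min_rV (ex_intro _ 0 (lexx _)) (bounded_closed_compact Abnd Acl)
  (continuous_subspaceT gcont).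
rewrite inE => Ap pmin; exists p.
have gTp : g (T p) <= k * g p by exact: Tk.
have gp0 : 0 <= g p := enorm_ge0 _.
have : g p <= g (T p).
  apply: pmin; rewrite inE /A /= (le_trans gTp)// (le_trans _ Ap)//.
  by rewrite ler_piMl// ltW.
move=> le_g; have /eqP : g p = 0.
  by apply/eqP; rewrite eq_le gp0 andbT; nra.
rewrite /g /enorm sqrtr_eq0 le_eqVlt ltNge dot_ge0 orbF dot_eq0 subr_eq0.
by move=> /eqP.
Qed.

End euclidean_geometry.

(** * Projection onto a closed convex set *)

Section projection.
Context {R : realType} {n : nat}.
Implicit Types (u v w x y p q : 'rV[R]_n).
Variable X : set 'rV[R]_n.
Hypotheses (X0 : X !=set0) (Xcl : closed X) (Xconv : convex_set X).

Lemma is_eproj_eproj v : is_eproj X v (eproj X v).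
Proof.
suff : exists p, is_eproj X v p by exact: xgetPex.
have [x Xx] := X0; pose A := X `&` [set y | enorm (v - y) <= enorm (v - x)].
have dist_cont : continuous (fun y => enorm (v - y)).
  move=> y; apply: (@continuous_comp _ _ _ (fun y => v - y) (@enorm R n)).
    by apply: continuousB; [exact: cst_continuous|exact: cvg_id].
  exact: enorm_continuous.
have Acl : closed A.
  apply: closedI => //.
  apply: (@preimage_closed _ _ _ [set r | r <= _]); last exact: closed_le.
  by move=> ? _; exact: dist_cont.
have Abnd : bounded_set A.
  exists (`|v| + enorm (v - x)); split; first exact: num_real.
  move=> M ltM y [_ Ay]; apply: le_trans (ltW ltM).
  rewrite -[y](subKr v) (le_trans (ler_normB _ _))// lerD2l.
  exact: le_trans (sup_norm_le_enorm _) Ay.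
have [p] := @EVT_min_rV R n (fun y => enorm (v - y)) A
  (ex_intro _ x (conj Xx (lexx _))) (bounded_closed_compact Abnd Acl)
  (continuous_subspaceT dist_cont).
rewrite inE => -[Xp px] pmin; exists p; split => // y Xy.
have [yx|xy] := leP (enorm (v - y)) (enorm (v - x)).
  by apply: pmin; rewrite inE.
exact: le_trans px (ltW xy).
Qed.

Lemma eproj_in v : X (eproj X v).
Proof. by have [] := is_eproj_eproj v. Qed.

(** First-order optimality of the projection along the segment from
    [eproj X v] to [y]. *)
Lemma eproj_vi v y : X y -> dot (v - eproj X v) (y - eproj X v) <= 0.
Proof.
move=> Xy; have [Xp pmin] := is_eproj_eproj v; set p := eproj X v in Xp pmin *.
rewrite leNgt; apply/negP => c0.
set c := dot _ _ in c0; set s := dot (y - p) (y - p).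
have s0 : 0 <= s := dot_ge0 _.
(* at this point of the segment the linear gain [2 * t * c] exceeds the
   quadratic loss [t ^+ 2 * s] *)
pose t := c / (c + s).
have t0 : 0 < t by rewrite divr_gt0// ltr_pwDl.
have t1 : t <= 1 by rewrite ler_pdivrMr ?ltr_pwDl// mul1r lerDl.
have Xq : X (p + t *: (y - p)).
  have := Xconv (Itv01 (ltW t0) t1) (mem_set Xy) (mem_set Xp).
  rewrite inE /conv/=; have -> // : t *: y + unstable.onem t *: p = p + t *: (y - p).
  by rewrite /unstable.onem scalerBl scale1r scalerBr addrCA.
have := pmin _ Xq; rewrite ler_enorm opprD addrA.
rewrite [leRHS]dot_subZ -/c -/s => le_c.
have ts : t * s < c.
  by rewrite mulrAC ltr_pdivrMr ?ltr_pwDl// mulrDr ltrDr mulr_gt0.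
nra.
Qed.

Lemma eproj_unique v p :
  X p -> (forall y, X y -> dot (v - p) (y - p) <= 0) -> eproj X v = p.
Proof.
move=> Xp pvi; have := eproj_vi v Xp; have := pvi _ (eproj_in v).
set q := eproj X v => h1 h2; apply/eqP; rewrite -subr_eq0 -dot_eq0 eq_le dot_ge0.
rewrite andbT; move: h1 h2; rewrite !dotE (dotC q p); lra.
Qed.

(** Add the two optimality conditions, each tested at the other projection. *)
Lemma eproj_firmly_nonexpansive u v :
  dot (eproj X u - eproj X v) (eproj X u - eproj X v) <=
  dot (eproj X u - eproj X v) (u - v).
Proof.
have := eproj_vi u (eproj_in v); have := eproj_vi v (eproj_in u).
set p := eproj X u; set q := eproj X v.
rewrite !dotE (dotC q p) (dotC u p) (dotC u q) (dotC v p) (dotC v q); lra.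
Qed.

Lemma eproj_nonexpansive u v :
  dot (eproj X u - eproj X v) (eproj X u - eproj X v) <= dot (u - v) (u - v).
Proof.
have := eproj_firmly_nonexpansive u v.
have := dot_ge0 ((eproj X u - eproj X v) - (u - v)).
by move: (eproj X u - _) (u - v) => d e; rewrite !dotE (dotC e d); lra.
Qed.

End projection.

(** * The projection step and strongly monotone problems *)

(** The direction of one inverse projected gradient step from [x] when the
    oracle returned [v]; at [v = F x] it is the residual of the problem. *)
Definition ipg_dir {R : realType} {n : nat} (X : set 'rV[R]_n) (eta : R)
  (v x : 'rV[R]_n) : 'rV[R]_n := v - eproj X (v - eta *: x).

Section ipg_step.
Context {R : realType} {n : nat}.
Implicit Types (u v w x y p q : 'rV[R]_n) (f F Phi : 'rV[R]_n -> 'rV[R]_n).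
Variable X : set 'rV[R]_n.
Hypotheses (X0 : X !=set0) (Xcl : closed X) (Xconv : convex_set X).

(** Two steps, one of them perturbed by an error [w], get closer. Firm
    nonexpansiveness of the projection gives
    [dot a e + dot w e - dot d e <= eta^-1 * (dot a d + dot w d - dot d d)]
    with [e := x - y] and [a := f x - f y]. The modulus [L ^+ 2 / eta] is exactly
    what pays for the cross term [dot a d] through the Lipschitz bound on [a],
    with half of the monotonicity left over; and with the step size
    [(8 * eta)^-1] the term [- dot d d] dominates the quadratic term of the
    update. Young's inequality turns the products with [w] into [dot w w]. *)
Lemma ipg_step_le f (L eta : R) x y w : 0 < L -> 0 < eta ->
  L ^+ 2 / eta * dot (x - y) (x - y) <= dot (f x - f y) (x - y) ->
  dot (f x - f y) (f x - f y) <= L ^+ 2 * dot (x - y) (x - y) ->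
  forall d, d = ipg_dir X eta (f x + w) x - ipg_dir X eta (f y) y ->
  dot (x - y - (8 * eta)^-1 *: d) (x - y - (8 * eta)^-1 *: d) <=
    (1 - (L / eta) ^+ 2 / 16) * dot (x - y) (x - y)
    - 3 / 64 * eta^-1 ^+ 2 * dot d d
    + (L^-1 ^+ 2 + eta^-1 ^+ 2) / 4 * dot w w.
Proof.
move=> L0 eta0 mono lip d dE.
have := eproj_firmly_nonexpansive X0 Xcl Xconv (f x + w - eta *: x) (f y - eta *: y).
set q := eproj X _ - eproj X _ => firm.
have {}dE : d = f x - f y + w - q.
  by rewrite dE /ipg_dir /q; apply/rowP => i; rewrite !mxE; ring.
have uE : f x + w - eta *: x - (f y - eta *: y) = f x - f y + w - eta *: (x - y).
  by apply/rowP => i; rewrite !mxE; ring.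
move: firm; rewrite uE.
have -> : q = f x - f y + w - d by rewrite dE opprB addrCA subrr addr0.
rewrite dot_subZ; clear dE uE q.
move: (x - y) (f x - f y) mono lip => e a mono lip firm.
set h := eta^-1; have h0 : 0 < h by rewrite invr_gt0.
have {}firm : dot a e + dot w e - dot d e <= h * (dot a d + dot w d - dot d d).
  rewrite mulrC ler_pdivlMr// -subr_ge0; move: firm.
  by rewrite !dotE (dotC d a) (dotC d w) (dotC w a); lra.
have kE : (L ^+ 2 / eta)^-1 = L^-1 ^+ 2 * eta by field; rewrite !gt_eqF.
have k0 : 0 < L ^+ 2 / eta by rewrite divr_gt0// exprn_gt0.
have two0 : 0 < 2 :> R by rewrite ltr0n.
(* the weights leave a quarter of [dot d d] and of the modulus *)
have yad := @young_dot R n 1 a d ltr01.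
have ywd := @young_dot R n 2 w d two0.
have ywe := @young_dotN R n (L ^+ 2 / eta / 2) e w (divr_gt0 k0 two0).
rewrite invr1 !mul1r in yad; rewrite invf_div kE -/h in ywe; rewrite -/h in mono.
have -> : (8 * eta)^-1 = h / 8 by rewrite invfM mulrC.
have step : - dot d e <= - (L ^+ 2 * h / 4) * dot e e - h / 4 * dot d d
    + (L^-1 ^+ 2 * eta + h) * dot w w.
  have had : dot a d + dot w d - dot d d <=
      L ^+ 2 / 2 * dot e e + dot w w - dot d d / 4 by lra.
  have hd := ler_wpM2l (ltW h0) had.
  by move: ywe; rewrite (dotC e w); lra.
have h4 : 0 <= h / 4 by rewrite divr_ge0// ltW.
have {}step := ler_wpM2l h4 step.
have -> : (L^-1 ^+ 2 + h ^+ 2) / 4 = h / 4 * (L^-1 ^+ 2 * eta + h).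
  by rewrite /h; field; rewrite !gt_eqF.
by rewrite (dotC e d); lra.
Qed.

(** The projection characterizes the solutions as the points where the step
    does not move, whatever the value of [eta]. *)
Lemma ipg_dir_eq0 (eta : R) f x : 0 < eta ->
  ipg_dir X eta (f x) x = 0 <-> sivi_solutions X f x.
Proof.
move=> eta0; split=> [/eqP|[Xfx vi]].
  rewrite /ipg_dir subr_eq0 => /eqP fxE; split => [|y Xy].
    by rewrite fxE; exact: eproj_in.
  have := eproj_vi X0 Xcl Xconv (f x - eta *: x) Xy.
  rewrite -fxE addrAC subrr add0r dotNl dotZl dotC oppr_le0.
  by rewrite pmulr_rge0.
apply/eqP; rewrite /ipg_dir subr_eq0 eq_sym; apply/eqP.
apply: eproj_unique => // y Xy.
rewrite addrAC subrr add0r dotNl dotZl dotC oppr_le0.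
by rewrite mulr_ge0 ?vi// ltW.
Qed.

(** A strongly monotone problem has a solution because its error-free step is a
    contraction. *)
Lemma sivi_solution_exists f (L eta : R) : 0 < L -> 0 < eta ->
  (forall x y, L ^+ 2 / eta * dot (x - y) (x - y) <= dot (f x - f y) (x - y)) ->
  (forall x y, dot (f x - f y) (f x - f y) <= L ^+ 2 * dot (x - y) (x - y)) ->
  sivi_solutions X f !=set0.
Proof.
move=> L0 eta0 mono lip.
have rho1 : 1 - (L / eta) ^+ 2 / 16 < 1.
  by rewrite gtrBl divr_gt0// exprn_gt0// divr_gt0.
pose T x : 'rV[R]_n := x - (8 * eta)^-1 *: ipg_dir X eta (f x) x.
have [|p Tp] := @contraction_fixed_point R n _ T rho1.
  move=> x y; have := @ipg_step_le f L eta x y 0 L0 eta0 (mono x y) (lip x y) _ erefl.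
  rewrite addr0; set d := ipg_dir _ _ _ x - _.
  have -> : x - y - (8 * eta)^-1 *: d = T x - T y.
    by rewrite /T scalerBr; apply/rowP => i; rewrite !mxE; ring.
  rewrite dot0l.
  have := dot_ge0 d; have : 0 <= 3 / 64 * eta^-1 ^+ 2 by rewrite mulr_ge0// sqr_ge0.
  rewrite mulr0 addr0 => c0 d0 /le_trans; apply.
  by rewrite gerBl mulr_ge0.
exists p; apply/(ipg_dir_eq0 f p eta0).
move/eqP: Tp; rewrite /T subr_eq addrC -subr_eq subrr eq_sym scaler_eq0.
by rewrite invr_eq0 gt_eqF ?mulr_gt0//= => /eqP.
Qed.

(** Test the two variational inequalities at each other's values: the
    strong monotonicity of [la *: Phi] is then paid by the perturbation
    [(la - la') *: Phi q] alone, so the distance only involves [Phi] at [q]. *)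
Lemma regularized_solution_dist F Phi (mu la la' : R) p q :
  monotone_map F -> 0 < mu -> strongly_monotone_map mu Phi -> 0 < la ->
  sivi_solutions X (fun x => F x + la *: Phi x) p ->
  sivi_solutions X (fun x => F x + la' *: Phi x) q ->
  dot (p - q) (p - q) <= ((la - la') / (la * mu)) ^+ 2 * dot (Phi q) (Phi q).
Proof.
move=> Fm mu0 Phim la0 [Xp vip] [Xq viq].
have := vip _ Xq; have := viq _ Xp; rewrite /= => hq hp.
have := Fm p q; have := Phim p q; rewrite enorm_sqr => hPhi hF.
have t0 : 0 < la * mu by rewrite mulr_gt0.
have := @young_dotN R n (la * mu) (p - q) ((la - la') *: Phi q) t0.
rewrite !(dotZl, dotZr) (dotC (p - q) (Phi q)) => young.
have {}hPhi := ler_wpM2l (ltW la0) hPhi.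
have pq : la * mu * dot (p - q) (p - q) <=
    (la * mu)^-1 * ((la - la') * ((la - la') * dot (Phi q) (Phi q))).
  move: hq hp hF hPhi young; rewrite !dotE; lra.
rewrite -(ler_pM2l t0) (le_trans pq)// le_eqVlt; apply/orP; left; apply/eqP.
by field; rewrite !gt_eqF.
Qed.

End ipg_step.

(** * One iteration on the regularized problems *)

Section regularized_problem.
Context {R : realType} {n : nat}.
Implicit Types (u v w x y p q : 'rV[R]_n).
Variables (X : set 'rV[R]_n) (F Phi : 'rV[R]_n -> 'rV[R]_n) (L1 L2 mu : R).
Hypotheses (X0 : X !=set0) (Xcl : closed X) (Xconv : convex_set X).
Hypotheses (Fmono : monotone_map F) (Flip : lipschitz_map L1 F).
Hypotheses (mu0 : 0 < mu) (Phimono : strongly_monotone_map mu Phi).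
Hypothesis Philip : lipschitz_map L2 Phi.
Hypotheses (L1_ge0 : 0 <= L1) (mu_le_L2 : mu <= L2).

Let L := L1 + L2.
Let C1 := L ^+ 2 / mu.
Definition regularized (la : R) x := F x + la *: Phi x.

Let L2_gt0 : 0 < L2. Proof. exact: lt_le_trans mu_le_L2. Qed.
Let L_gt0 : 0 < L. Proof. by rewrite ltr_wpDl. Qed.
Let C1_gt0 : 0 < C1. Proof. by rewrite divr_gt0// exprn_gt0. Qed.

Lemma dot_lipschitz (K : R) f x y : lipschitz_map K f ->
  dot (f x - f y) (f x - f y) <= K ^+ 2 * dot (x - y) (x - y).
Proof.
move=> /(_ x y) fle; rewrite -!enorm_sqr -exprMn lerXn2r ?nnegrE ?enorm_ge0//.
exact: le_trans (enorm_ge0 _) fle.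
Qed.

Lemma regularized_lipschitz la : 0 <= la <= 1 -> lipschitz_map L (regularized la).
Proof.
move=> /andP[la0 la1] x y.
have -> : regularized la x - regularized la y = (F x - F y) + la *: (Phi x - Phi y).
  by rewrite /regularized; apply/rowP => i; rewrite !mxE; ring.
apply: le_trans (enormD _ _) _; rewrite enormZ ger0_norm// mulrDl lerD//.
rewrite -[leRHS]mul1r ler_pM ?enorm_ge0//.
Qed.

Lemma regularized_strongly_monotone la : 0 <= la ->
  strongly_monotone_map (la * mu) (regularized la).
Proof.
move=> la0 x y.
have -> : regularized la x - regularized la y = (F x - F y) + la *: (Phi x - Phi y).
  by rewrite /regularized; apply/rowP => i; rewrite !mxE; ring.
rewrite dotDl dotZl -mulrA ler_wpDl//; exact: ler_wpM2l.
Qed.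

Let eta_def la : 0 < la -> L ^+ 2 / (C1 / la) = la * mu.
Proof. by move=> la0; rewrite /C1; field; rewrite !gt_eqF. Qed.

Lemma regularized_solution_exists la : 0 < la -> la <= 1 ->
  sivi_solutions X (regularized la) !=set0.
Proof.
move=> la0 la1.
apply: (@sivi_solution_exists _ _ _ X0 Xcl Xconv _ L (C1 / la)) => //.
- exact: divr_gt0.
- move=> x y; rewrite eta_def// -enorm_sqr.
  by apply: regularized_strongly_monotone; rewrite ltW.
- by move=> x y; apply/dot_lipschitz/regularized_lipschitz; rewrite ltW.
Qed.

Lemma dot_Phi_le x y :
  dot (Phi x) (Phi x) <= 2 * L2 ^+ 2 * dot (x - y) (x - y) + 2 * dot (Phi y) (Phi y).
Proof.
rewrite -{1 2}(subrK (Phi y) (Phi x)); apply: le_trans (dotD_le _ _) _.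
by rewrite lerD2r -mulrA ler_pM2l// dot_lipschitz.
Qed.

(** Regularized solutions stay within a fixed distance of any solution of the
    original problem, whence a bound on [Phi] that is uniform in [la]. *)
Lemma dot_Phi_solution_le xs la p : sivi_solutions X F xs -> 0 < la ->
  sivi_solutions X (regularized la) p ->
  dot (Phi p) (Phi p) <= 2 * ((L2 / mu) ^+ 2 + 1) * dot (Phi xs) (Phi xs).
Proof.
move=> xs_sol la0 p_sol.
have xs_sol0 : sivi_solutions X (fun x => F x + 0 *: Phi x) xs.
  by move: xs_sol; congr (sivi_solutions X _ xs); apply/funext => x; rewrite scale0r addr0.
have := regularized_solution_dist Fmono mu0 Phimono la0 p_sol xs_sol0.
have -> : (la - 0) / (la * mu) = mu^-1 by field; rewrite !gt_eqF.
move=> dist_le; apply: le_trans (dot_Phi_le p xs) _.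
by have := ler_wpM2l (sqr_ge0 L2) dist_le; lra.
Qed.

(** Changing the oracle value by [z] moves the projection by at most [z]. *)
Lemma ipg_dir_perturb (eta : R) v z x :
  dot (ipg_dir X eta v x) (ipg_dir X eta v x) <=
  2 * dot (ipg_dir X eta (v + z) x) (ipg_dir X eta (v + z) x) + 8 * dot z z.
Proof.
have := eproj_nonexpansive X0 Xcl Xconv (v + z - eta *: x) (v - eta *: x).
set s := eproj X _ - _.
have -> : v + z - eta *: x - (v - eta *: x) = z.
  by apply/rowP => i; rewrite !mxE; ring.
move=> s_le.
have -> : ipg_dir X eta v x = ipg_dir X eta (v + z) x + (s - z).
  by rewrite /ipg_dir /s; apply/rowP => i; rewrite !mxE; ring.
apply: le_trans (dotD_le _ _) _; rewrite lerD2l.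
by have := dotB_le s z; lra.
Qed.

(** [contraction_rate * la ^+ 2] is the contraction [(L / eta) ^+ 2 / 16] of one
    step at [eta = C1 / la]. *)
Definition contraction_rate := (mu / L) ^+ 2 / 16.
(** Small enough for two purposes: [2 * residual_weight] is below the
    coefficient [3 / 64 * C1^-1 ^+ 2] of the squared direction, and
    [32 * residual_weight * L2 ^+ 2] is below a quarter of [contraction_rate]. *)
Definition residual_weight := (32 * 64 * C1 ^+ 2)^-1.
Definition error_const (M : R) :=
  (L^-1 ^+ 2 + C1^-1 ^+ 2) / 2 + 16 * residual_weight
  + ((1 + 2 / contraction_rate) / mu ^+ 2 + 32 * residual_weight) * M.

Let c0 := contraction_rate.
Let b0 := residual_weight.

Lemma contraction_rate_gt0 : 0 < c0.
Proof. by rewrite divr_gt0// exprn_gt0// divr_gt0. Qed.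

Lemma contraction_rate_le1 : c0 <= 1.
Proof.
have muL : mu / L <= 1 by rewrite ler_pdivrMr// mul1r (le_trans mu_le_L2)// lerDr.
have muL0 : 0 <= mu / L by rewrite divr_ge0// ltW.
by rewrite /c0 /contraction_rate; nra.
Qed.

Lemma residual_weight_gt0 : 0 < b0.
Proof. rewrite /b0 /residual_weight invr_gt0; apply: mulr_gt0; [exact: mulr_gt0|exact: exprn_gt0]. Qed.

Let error_coef_ge0 : 0 <= (1 + 2 / c0) / mu ^+ 2 + 32 * b0.
Proof.
have c_gt0 := contraction_rate_gt0; have b_gt0 := residual_weight_gt0.
apply: addr_ge0; last by rewrite mulr_ge0// ltW.
by rewrite divr_ge0 ?sqr_ge0// addr_ge0// divr_ge0// ltW.
Qed.

Lemma error_const_gt0 M : 0 <= M -> 0 < error_const M.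
Proof.
move=> M0; rewrite /error_const -/b0 -/c0 ltr_pwDl ?mulr_ge0//.
rewrite addr_gt0 ?mulr_gt0 ?residual_weight_gt0//.
by rewrite addr_gt0// exprn_gt0// invr_gt0.
Qed.

Let residual_weightE : b0 = C1^-1 ^+ 2 / (32 * 64).
Proof. by rewrite /b0 /residual_weight invfM mulrC exprVn. Qed.

Let residual_weight_L2 : 32 * b0 * L2 ^+ 2 <= c0 / 4.
Proof.
have L2L : L2 ^+ 2 <= L ^+ 2.
  by rewrite lerXn2r ?nnegrE ?lerDr// ltW.
have -> : c0 / 4 = 32 * b0 * L ^+ 2.
  by rewrite residual_weightE /c0 /contraction_rate /C1; field; rewrite !gt_eqF.
by rewrite ler_pM2l// mulr_gt0// residual_weight_gt0.
Qed.

(** The scalar bookkeeping of one iteration. With [r] the square of the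
    regularization parameter, half of the contraction [c0 * r] absorbs the move
    from one regularized solution to the next, a quarter absorbs the bias that
    the regularization induces on the residual. *)
Lemma one_step_scalar (M r E E1 E' D dd ww zz PP H : R) :
  0 <= M -> 0 < r -> r <= 1 -> 0 <= E -> 0 <= dd -> 0 <= ww ->
  E1 <= (1 - c0 * r) * E - 3 / 64 * (C1^-1 ^+ 2 * r) * dd
        + (L^-1 ^+ 2 + C1^-1 ^+ 2 * r) / 4 * ww ->
  E' <= (1 + c0 * r / 2) * E1 + (1 + (c0 * r / 2)^-1) * D ->
  D <= r ^+ 4 * (M / mu ^+ 2) ->
  H <= 2 * dd + 8 * zz -> zz <= 2 * r * PP + 2 * ww ->
  PP <= 2 * L2 ^+ 2 * E + 2 * M ->
  E' + b0 * r * H <= (1 - c0 / 4 * r) * E + error_const M * (ww + r ^+ 2).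
Proof.
move=> M0 r0 r1 E0 dd0 ww0 leE1 leE' leD leH lezz lePP.
have c_gt0 := contraction_rate_gt0; have c_le1 := contraction_rate_le1.
have b_gt0 := residual_weight_gt0; have bL2 := residual_weight_L2.
set k := C1^-1 ^+ 2 in leE1; set l := L^-1 ^+ 2 in leE1.
have k0 : 0 <= k by rewrite sqr_ge0.
have l0 : 0 <= l by rewrite sqr_ge0.
have bk : b0 = k / (32 * 64) := residual_weightE.
have r_ge0 := ltW r0; have c_ge0 := ltW c_gt0; have b_ge0 := ltW b_gt0.
have s0 : 0 <= 3 / 64 :> R by rewrite divr_ge0.
have rr : r ^+ 2 <= r by rewrite expr2 ler_piMr// ltW.
have rr0 : 0 <= r ^+ 2 := sqr_ge0 _.
have step1 : (1 + c0 * r / 2) * E1 <=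
    (1 - c0 * r / 2) * E - 3 / 64 * (k * r) * dd + (l + k) / 2 * ww.
  set t := c0 * r / 2.
  have t0 : 0 <= t by rewrite divr_ge0// mulr_ge0// ltW.
  have t1 : t <= 1 by rewrite /t; nra.
  have t1_ge0 : 0 <= 1 + t by rewrite addr_ge0.
  apply: le_trans (ler_wpM2l t1_ge0 leE1) _.
  have -> : c0 * r = 2 * t by rewrite /t; field.
  have A0 : 0 <= 3 / 64 * (k * r) * dd by rewrite 3?mulr_ge0.
  have tA := mulr_ge0 t0 A0.
  have B1 : (l + k * r) / 4 * ww <= (l + k) / 4 * ww.
    by rewrite ler_wpM2r// ler_pM2r// lerD2l ler_piMr.
  have tB := ler_wpM2l t1_ge0 B1.
  have B0 : 0 <= (l + k) / 4 * ww by rewrite mulr_ge0// divr_ge0// addr_ge0.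
  have tB0 : 0 <= (1 - t) * ((l + k) / 4 * ww) by rewrite mulr_ge0// subr_ge0.
  have ttE := mulr_ge0 (mulr_ge0 t0 t0) E0.
  by lra.
have step2 : (1 + (c0 * r / 2)^-1) * D <= (1 + 2 / c0) / mu ^+ 2 * M * r ^+ 2.
  have -> : (c0 * r / 2)^-1 = 2 / c0 / r by field; rewrite !gt_eqF.
  have cr : 0 <= 1 + 2 / c0 / r by rewrite addr_ge0// 2?divr_ge0.
  apply: le_trans (ler_wpM2l cr leD) _.
  have -> : (1 + 2 / c0 / r) * (r ^+ 4 * (M / mu ^+ 2)) =
      (r ^+ 2 + 2 / c0 * r) * (M / mu ^+ 2 * r ^+ 2).
    by field; rewrite !gt_eqF.
  have -> : (1 + 2 / c0) / mu ^+ 2 * M * r ^+ 2 =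
      (1 + 2 / c0) * (M / mu ^+ 2 * r ^+ 2) by field; rewrite !gt_eqF.
  apply: ler_wpM2r; first by rewrite mulr_ge0// divr_ge0// sqr_ge0.
  by rewrite lerD//; [exact: le_trans rr r1|rewrite ler_piMr// divr_ge0].
have step3 : b0 * r * H <= 3 / 64 * (k * r) * dd + c0 / 4 * r * E
    + 32 * b0 * M * r ^+ 2 + 16 * b0 * ww.
  have br : 0 <= b0 * r by rewrite mulr_ge0.
  apply: le_trans (ler_wpM2l br leH) _.
  have h1 := ler_wpM2l br lezz.
  have brr : 0 <= b0 * r * r by rewrite mulr_ge0.
  have h2 := ler_wpM2l brr lePP.
  have h3 : b0 * r * ww <= b0 * ww by rewrite ler_wpM2r// ler_piMr.
  have h4 : 32 * b0 * L2 ^+ 2 * (r ^+ 2 * E) <= c0 / 4 * (r * E).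
    by apply: ler_pM => //; rewrite ?ler_wpM2r// mulr_ge0 ?sqr_ge0// mulr_ge0.
  have h5 : 2 * (b0 * r) * dd <= 3 / 64 * (k * r) * dd.
    rewrite bk; have := mulr_ge0 (mulr_ge0 k0 r_ge0) dd0.
    by lra.
  by lra.
have lk0 : 0 <= (l + k) / 2 * r ^+ 2 + 16 * b0 * r ^+ 2.
  apply: addr_ge0; apply: mulr_ge0 => //; last exact: mulr_ge0.
  by rewrite divr_ge0// addr_ge0.
have Mw0 : 0 <= ((1 + 2 / c0) / mu ^+ 2 + 32 * b0) * M * ww.
  by rewrite mulr_ge0// mulr_ge0.
rewrite /error_const -/k -/l -/b0 -/c0.
by lra.
Qed.

(** [ipg_step_le] controls the distance to the current regularized solution
    [p]. Passing to the next one [q] costs, by Young's inequality, the squared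
    move divided by the contraction [la ^+ 2]; since [la - la' <= la ^+ 5] the
    move is [O(la ^+ 4)], so this cost stays below the order of [la ^+ 4]. The
    residual of [F] differs from the step direction by at most twice the bias
    [la *: Phi x] plus the error [w]. *)
Lemma one_step (M la la' eta : R) p q x w :
  0 <= M -> 0 < la -> la <= 1 -> eta = C1 / la ->
  la' <= la -> la - la' <= la ^+ 5 ->
  sivi_solutions X (regularized la) p -> sivi_solutions X (regularized la') q ->
  dot (Phi p) (Phi p) <= M -> dot (Phi q) (Phi q) <= M ->
  forall d, d = ipg_dir X eta (regularized la x + w) x ->
  dot (x - (8 * eta)^-1 *: d - q) (x - (8 * eta)^-1 *: d - q)
    + b0 * la ^+ 2 * enorm (residual X F x eta) ^+ 2
  <= (1 - c0 / 4 * la ^+ 2) * dot (x - p) (x - p)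
     + error_const M * (dot w w + (la ^+ 2) ^+ 2).
Proof.
move=> M0 la0 la1 etaE la'_le gap p_sol q_sol PhipM PhiqM d dE.
have eta0 : 0 < eta by rewrite etaE divr_gt0.
have la_ge0 := ltW la0.
have r0 : 0 < la ^+ 2 by rewrite exprn_gt0.
have r1 : la ^+ 2 <= 1 by rewrite expr_le1.
have c_gt0 := contraction_rate_gt0.
have p_fix : ipg_dir X eta (regularized la p) p = 0 by apply/ipg_dir_eq0.
set e := x - p - (8 * eta)^-1 *: d.
have estep : dot e e <= (1 - c0 * la ^+ 2) * dot (x - p) (x - p)
    - 3 / 64 * (C1^-1 ^+ 2 * la ^+ 2) * dot d d
    + (L^-1 ^+ 2 + C1^-1 ^+ 2 * la ^+ 2) / 4 * dot w w.
  have <- : eta^-1 ^+ 2 = C1^-1 ^+ 2 * la ^+ 2.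
    by rewrite etaE invf_div exprMn mulrC.
  have <- : (L / eta) ^+ 2 / 16 = c0 * la ^+ 2.
    by rewrite etaE /c0 /contraction_rate /C1; field; rewrite !gt_eqF.
  apply: (@ipg_step_le _ _ X X0 Xcl Xconv (regularized la)) => //; last by rewrite p_fix subr0.
  - rewrite etaE eta_def// -enorm_sqr.
    exact: regularized_strongly_monotone.
  - by apply/dot_lipschitz/regularized_lipschitz; rewrite la_ge0.
have pqle : dot (p - q) (p - q) <= (la ^+ 2) ^+ 4 * (M / mu ^+ 2).
  apply: le_trans (regularized_solution_dist Fmono mu0 Phimono la0 p_sol q_sol) _.
  have -> : (la - la') / (la * mu) = (la - la') / la / mu.
    by field; rewrite !gt_eqF.
  rewrite expr_div_n -mulrA -exprM.
  have gap0 : 0 <= (la - la') / la by rewrite divr_ge0// subr_ge0.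
  have gap1 : (la - la') / la <= la ^+ 4 by rewrite ler_pdivrMr// -exprSr.
  apply: ler_pM; rewrite ?sqr_ge0//.
  - by rewrite mulr_ge0 ?dot_ge0// invr_ge0 sqr_ge0.
  - by rewrite (exprM la 4 2) lerXn2r// nnegrE exprn_ge0.
  - by rewrite mulrC ler_wpM2r// invr_ge0 sqr_ge0.
have -> : x - (8 * eta)^-1 *: d - q = e + (p - q).
  by rewrite /e; apply/rowP => i; rewrite !mxE; ring.
have t0 : 0 < c0 * la ^+ 2 / 2 by rewrite divr_gt0// mulr_gt0.
have esum := dotD_weighted e (p - q) t0.
have Hle := ipg_dir_perturb eta (F x) (la *: Phi x + w) x.
rewrite addrA -/(regularized la x) -dE in Hle.
have zle : dot (la *: Phi x + w) (la *: Phi x + w) <=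
    2 * la ^+ 2 * dot (Phi x) (Phi x) + 2 * dot w w.
  by apply: le_trans (dotD_le _ _) _; rewrite dotZl dotZr expr2 !mulrA.
have Phile : dot (Phi x) (Phi x) <= 2 * L2 ^+ 2 * dot (x - p) (x - p) + 2 * M.
  by apply: le_trans (dot_Phi_le x p) _; rewrite lerD2l ler_pM2l.
rewrite enorm_sqr.
exact: (one_step_scalar M0 r0 r1 (dot_ge0 _) (dot_ge0 _) (dot_ge0 _) estep esum
  pqle Hle zle Phile).
Qed.

End regularized_problem.

(** * Means of possibly non-measurable functions *)

Section mean_bounds.
Context {dT : measure_display} {Omega : measurableType dT} {R : realType}.
Variable P : probability Omega R.
Implicit Types (f g : Omega -> R) (a b : R).

(** Integrability is part of the bound, so that bounds can be added and scaled. *)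
Definition mean_le f a :=
  P.-integrable setT (EFin \o f) /\ (\int[P]_w (f w)%:E <= a%:E)%E.

Lemma mean_le_cst a : mean_le (cst a) a.
Proof.
split; first exact: finite_measure_integrable_cst.
by have := expectation_cst P a; rewrite unlock => ->.
Qed.

Lemma mean_leD f g a b :
  mean_le f a -> mean_le g b -> mean_le (fun w => f w + g w) (a + b).
Proof.
move=> [If fa] [Ig gb]; split.
  by apply: eq_integrable (integrableD _ If Ig).
under eq_integral do rewrite EFinD.
by rewrite integralD// EFinD leeD.
Qed.

Lemma mean_leZ (c : R) f a : 0 <= c -> mean_le f a -> mean_le (fun w => c * f w) (c * a).
Proof.
move=> c0 [If fa]; split.
  by apply: eq_integrable (integrableZl _ c If).
under eq_integral do rewrite EFinM.
by rewrite integralZl// EFinM lee_wpmul2l ?lee_fin.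
Qed.

Lemma mean_le_sum (I : Type) (s : seq I) (f : I -> Omega -> R) (a : I -> R) :
  (forall i, mean_le (f i) (a i)) ->
  mean_le (fun w => \sum_(i <- s) f i w) (\sum_(i <- s) a i).
Proof.
move=> fa; elim: s => [|i s ih].
  rewrite big_nil; have -> : (fun w => \sum_(i <- [::]) f i w) = cst 0.
    by apply/funext => w; rewrite big_nil.
  exact: mean_le_cst.
rewrite big_cons; have -> : (fun w => \sum_(j <- i :: s) f j w) =
    (fun w => f i w + \sum_(j <- s) f j w).
  by apply/funext => w; rewrite big_cons.
exact: mean_leD.
Qed.

Lemma nonneg_mean_gt f a : (forall w, 0 <= f w) -> (a%:E < \int[P]_w (f w)%:E)%E ->
  exists2 h : {nnsfun Omega >-> R}, forall w, h w <= f w &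
    (a%:E < \int[P]_w (h w)%:E)%E.
Proof.
move=> f0; rewrite ge0_integralTE; last by move=> w; rewrite lee_fin.
move=> /ereal_sup_gt[_ [h hf <-]] ah; exists h => [w|]; first by rewrite -lee_fin.
by rewrite integral_nnsfun// patch_setT.
Qed.

(** The integral of a nonnegative function, measurable or not, is a supremum over
    the simple functions below it, so each [f i] may be replaced by a simple
    function whose mean is still above [a]. *)
Lemma sum_mean_gt (I : eqType) (s : seq I) (c : I -> R) (f : I -> Omega -> R)
    (V : Omega -> R) a v :
  (forall i, 0 <= c i) -> (forall i w, 0 <= f i w) ->
  (forall i, i \in s -> (a%:E < 'E_P[f i])%E) ->
  (forall w, \sum_(i <- s) c i * f i w <= V w) -> mean_le V v ->
  (\sum_(i <- s) c i) * a <= v.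
Proof.
move=> c0 f0 fa fV [IV Vv].
have /choice[h hP] : forall i, exists h : {nnsfun Omega >-> R},
    i \in s -> (forall w, h w <= f i w) /\ (a%:E < \int[P]_w (h w)%:E)%E.
  move=> i; have [si|_] := boolP (i \in s); last by exists (@nnsfun0 _ Omega R).
  have := fa i si; rewrite unlock => /(nonneg_mean_gt (f0 i))[h hf ah].
  by exists h.
rewrite -lee_fin; apply: le_trans Vv.
have ch0 i w : (0 <= (c i * h i w)%:E)%E by rewrite lee_fin mulr_ge0.
have mch i : measurable_fun setT (fun w => (c i * h i w)%:E).
  by apply/measurable_EFinP; apply: measurable_funM.
apply: (@le_trans _ _ (\int[P]_w (\sum_(i <- s) (c i * h i w)%:E)%E)%E); last first.
  apply: ge0_le_integral => //.
  - by move=> w _; apply: sume_ge0.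
  - exact: emeasurable_sum.
  - by case/integrableP: IV.
  - move=> w _; rewrite sumEFin lee_fin; apply: le_trans (fV w).
    rewrite big_seq [leRHS]big_seq; apply: ler_sum => i si.
    by rewrite ler_wpM2l// (hP i si).1.
rewrite ge0_integral_sum// mulr_suml -sumEFin.
rewrite big_seq [leRHS]big_seq; apply: lee_sum => i si.
under eq_integral do rewrite EFinM.
rewrite ge0_integralZl_EFin//; last first.
- by apply/measurable_EFinP.
- by move=> w _; rewrite lee_fin.
by rewrite EFinM lee_wpmul2l ?lee_fin// ltW// (hP i si).2.
Qed.

(** Test the conditional expectation on the whole space. *)
Lemma condexp_mean_le (S : set (set Omega)) (Z Y : Omega -> R) a :
  0 <= a -> S setT -> is_condexp P S Z Y -> {ae P, forall w, Y w <= a} ->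
  mean_le Z a.
Proof.
move=> a0 ST [IZ IY _ /(_ _ ST) YZ] Ya; split=> //; rewrite -YZ integralE.
apply: (@le_trans _ _ (\int[P]_w ((EFin \o Y)^\+ w))%E).
  by apply: geeDl; rewrite oppe_le0 integral_ge0.
rewrite -[leRHS]mule1 -(probability_setT P) -(integral_cst P measurableT).
apply: ae_ge0_le_integral => //.
- by case/integrableP: IY => mY _; exact: measurable_funepos.
- apply: filterS Ya => w Yw _.
  by rewrite funepos.unlock /= ge_max !lee_fin Yw.
Qed.

End mean_bounds.

(** * From the recursion to the rate *)

Section rate.
Context {dT : measure_display} {Omega : measurableType dT} {R : realType}.
Variable P : probability Omega R.

Definition isqrt (k : nat) : R := (Num.sqrt k.+1%:R)^-1.

Lemma isqrt_gt0 k : 0 < isqrt k.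
Proof. by rewrite invr_gt0 sqrtr_gt0 ltr0n. Qed.

Lemma isqrt_sqr k : isqrt k ^+ 2 = k.+1%:R^-1.
Proof. by rewrite exprVn sqr_sqrtr// ler0n. Qed.

Lemma isqrt_le1 k : isqrt k <= 1.
Proof.
by rewrite invf_le1 ?sqrtr_gt0 ?ltr0n// -[leLHS]sqrtr1 ler_sqrt ?ler0n// ler1n.
Qed.

Lemma isqrt_sqr_le k : isqrt k ^+ 2 <= isqrt k.
Proof. by rewrite expr2 ler_piMr ?isqrt_le1// ltW// isqrt_gt0. Qed.

Section recursion.
Variables (E H s : nat -> Omega -> R) (e0 b c C K : R).
Hypotheses (E_ge0 : forall k w, 0 <= E k w) (H_ge0 : forall k w, 0 <= H k w).
Hypotheses (E0_le : forall w, E 0 w <= e0).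
Hypotheses (b_gt0 : 0 < b) (c_gt0 : 0 < c) (c_le1 : c <= 1).
Hypotheses (C_ge0 : 0 <= C) (K_ge0 : 0 <= K).
Hypothesis rec : forall k w, E k.+1 w + b * isqrt k * H k w <=
  (1 - c * isqrt k) * E k w + C * (s k w + isqrt k ^+ 2).
Hypothesis s_mean : forall k, mean_le P (s k) (K * isqrt k ^+ 2).

(** The recursion with its nonnegative term dropped, solved with equality. It is
    measurable by construction, which is not known of [E] and [H]. *)
Fixpoint majorant (k : nat) (w : Omega) : R :=
  if k is k'.+1 then
    (1 - c * isqrt k') * majorant k' w + C * (s k' w + isqrt k' ^+ 2)
  else e0.

Let rate_ge0 k : 0 <= 1 - c * isqrt k.
Proof.
by rewrite subr_ge0 mulr_ile1 ?isqrt_le1// ltW// isqrt_gt0.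
Qed.

Lemma le_majorant k w : E k w <= majorant k w.
Proof.
elim: k => [|k ih] /=; first exact: E0_le.
have bH : 0 <= b * isqrt k * H k w.
  by rewrite !mulr_ge0// ltW// isqrt_gt0.
have := rec k w; have := ler_wpM2l (rate_ge0 k) ih; lra.
Qed.

Let err_mean k : mean_le P (fun w => C * (s k w + isqrt k ^+ 2))
  (C * (K + 1) * isqrt k ^+ 2).
Proof.
have -> : C * (K + 1) * isqrt k ^+ 2 = C * (K * isqrt k ^+ 2 + isqrt k ^+ 2).
  by ring.
apply: mean_leZ => //; apply: mean_leD; first exact: s_mean.
exact: mean_le_cst.
Qed.

Definition mean_bound := Num.max e0 (C * (K + 1) / c).

(** At the level [mean_bound] the contraction [c * isqrt k] outweighs the
    error, which is of the smaller order [isqrt k ^+ 2]. *)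
Lemma majorant_mean k : mean_le P (majorant k) mean_bound.
Proof.
suff [a ak aM] : exists2 a, mean_le P (majorant k) a & a <= mean_bound.
  by case: ak => I le_a; split => //; apply: le_trans le_a _; rewrite lee_fin.
elim: k => [|k [a ak aM]] /=.
  exists e0; first exact: mean_le_cst.
  by rewrite /mean_bound le_max lexx.
exists ((1 - c * isqrt k) * a + C * (K + 1) * isqrt k ^+ 2).
  apply: mean_leD; last exact: err_mean.
  exact: mean_leZ.
have h1 := ler_wpM2l (rate_ge0 k) aM.
have M_ge : C * (K + 1) <= mean_bound * c.
  by rewrite -ler_pdivrMr// /mean_bound le_max lexx orbT.
have CK : 0 <= C * (K + 1) by rewrite mulr_ge0// addr_ge0.
have h2 := ler_wpM2l CK (isqrt_sqr_le k).
have h3 := ler_wpM2r (ltW (isqrt_gt0 k)) M_ge.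
by lra.
Qed.

Lemma block_sum_le (m T : nat) w : (m <= T)%N ->
  \sum_(i <- iota m (T - m)) b * isqrt i * H i w <=
  majorant m w + \sum_(i <- iota m (T - m)) C * (s i w + isqrt i ^+ 2).
Proof.
move=> mT.
suff : E T w + \sum_(i <- iota m (T - m)) b * isqrt i * H i w <=
    E m w + \sum_(i <- iota m (T - m)) C * (s i w + isqrt i ^+ 2).
  by have := E_ge0 T w; have := le_majorant m w; lra.
rewrite -{1}(subnKC mT); elim: (T - m)%N => [|j ih].
  by rewrite !big_nil addn0.
rewrite -addn1 iotaD /= !big_cat /= !big_cons !big_nil !addr0 addn1 addnS.
have cE : 0 <= c * isqrt (m + j) * E (m + j) w.
  by rewrite !mulr_ge0// ltW// isqrt_gt0.
by have := rec (m + j) w; lra.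
Qed.

(** Summed over the block of indices from [T./2] to [T], the weights [isqrt]
    have total of order [sqrt T] while the squares of these weights, which
    bound the errors, have bounded total; over all indices below [T] the squares
    would add up to a spurious logarithm. *)
Lemma min_mean_rate : exists2 K', 0 < K' & forall T : nat, (1 <= T)%N ->
  (\big[Order.min/+oo]_(k < T) 'E_P[H k] <= (K' / Num.sqrt T%:R)%:E)%E.
Proof.
pose v := mean_bound + C * (K + 1).
have CK : 0 <= C * (K + 1) by rewrite mulr_ge0// addr_ge0.
have v_ge0 : 0 <= v.
  by rewrite addr_ge0// /mean_bound le_max (divr_ge0 CK (ltW c_gt0)) orbT.
exists (2 * (v + 1) / b); first by rewrite divr_gt0// mulr_gt0// ltr_wpDl.
move=> T T1; rewrite leNgt; apply/negP => /bigmin_gtP[_ Hgt].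
pose m := T./2; pose blk := iota m (T - m).
have Tm : (T = odd T + m + m)%N by rewrite -addnA addnn odd_double_half.
have mT : (m <= T)%N by rewrite Tm leq_addl.
have TT : 0 < T%:R :> R by rewrite ltr0n.
have sT : 0 < Num.sqrt T%:R :> R by rewrite sqrtr_gt0.
set a := 2 * (v + 1) / b / Num.sqrt T%:R in Hgt.
have a_ge0 : 0 <= a 
  by rewrite divr_ge0 ?(ltW sT)// divr_ge0 ?(ltW b_gt0)// mulr_ge0// addr_ge0.
have blkP i : i \in blk -> (m <= i < T)%N by rewrite mem_iota subnKC.
have errs : \sum_(i <- blk) C * (K + 1) * isqrt i ^+ 2 <= C * (K + 1).
  rewrite -mulr_sumr ler_piMr//.
  apply: (@le_trans _ _ (\sum_(i <- blk) m.+1%:R^-1)).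
    rewrite big_seq [leRHS]big_seq; apply: ler_sum => i /blkP /andP[mi _].
    by rewrite isqrt_sqr lef_pV2 ?posrE ?ltr0n// ler_nat.
  rewrite big_const_seq count_predT iter_addr_0 size_iota -[_ *+ _]mulr_natr.
  rewrite ler_pdivrMl ?ltr0n// mulr1 ler_nat.
  by rewrite [X in (X - _)%N]Tm addnK; case: (odd T).
have weights : b * (Num.sqrt T%:R / 2) <= \sum_(i <- blk) b * isqrt i.
  rewrite -mulr_sumr ler_wpM2l ?(ltW b_gt0)//.
  apply: (@le_trans _ _ (\sum_(i <- blk) (Num.sqrt T%:R)^-1)); last first.
    rewrite big_seq [leRHS]big_seq; apply: ler_sum => i /blkP /andP[_ iT].
    by rewrite lef_pV2 ?posrE ?sqrtr_gt0 ?ltr0n// ler_sqrt ?ler0n// ler_nat.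
  rewrite big_const_seq count_predT iter_addr_0 size_iota -[leRHS]mulr_natr.
  have -> : Num.sqrt T%:R / 2 = (Num.sqrt T%:R)^-1 * (T%:R / 2) :> R.
    by rewrite -{3}(sqr_sqrtr (ltW TT)); field; rewrite gt_eqF.
  rewrite ler_wpM2l ?invr_ge0 ?(ltW sT)// ler_pdivrMr// -natrM ler_nat.
  have -> : (T - m = odd T + m)%N by rewrite {1}Tm addnK.
  by rewrite {1}Tm muln2 -addnn addnA leq_add2r leq_addr.
have := @sum_mean_gt _ _ _ P _ blk (fun i => b * isqrt i) H
  (fun w => majorant m w + \sum_(i <- blk) C * (s i w + isqrt i ^+ 2)) a v.
have V_mean : mean_le P
    (fun w => majorant m w + \sum_(i <- blk) C * (s i w + isqrt i ^+ 2)) v.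
  have [I le_v] := mean_leD (majorant_mean m)
    (mean_le_sum blk (fun i => err_mean i)).
  by split => //; apply: le_trans le_v _; rewrite lee_fin lerD2l.
move=> /(_ _ _ _ _ V_mean) le_v.
have {}le_v : (\sum_(i <- blk) b * isqrt i) * a <= v.
  apply: le_v => //.
  - by move=> i; rewrite mulr_ge0// ltW// isqrt_gt0.
  - by move=> i /blkP /andP[_ iT]; exact: (Hgt (Ordinal iT)).
  - by move=> w; exact: block_sum_le.
have := ler_wpM2r a_ge0 weights.
have -> : b * (Num.sqrt T%:R / 2) * a = v + 1.
  by rewrite /a; field; rewrite !gt_eqF.
by lra.
Qed.

End recursion.
End rate.

(** * The stochastic iteration *)

Section lipschitz_constants.
Context {R : realType} {n : nat}.
Implicit Types f : 'rV[R]_n -> 'rV[R]_n.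

Let ones : 'rV[R]_n := const_mx 1.

Let enorm_ones_gt0 : (0 < n)%N -> 0 < enorm (ones - 0).
Proof.
move=> n0; rewrite subr0 sqrtr_gt0 /dot (eq_bigr (fun=> 1)).
  by rewrite sumr_const card_ord ltr0n.
by move=> i _; rewrite mxE mulr1.
Qed.

(** In dimension zero every constant is a Lipschitz constant, even a negative
    one. *)
Lemma lipschitz_constant_ge0 (K : R) f : (0 < n)%N -> lipschitz_map K f -> 0 <= K.
Proof.
move=> n0 /(_ ones 0) Kle; rewrite -(pmulr_lge0 _ (enorm_ones_gt0 n0)).
exact: le_trans (enorm_ge0 _) Kle.
Qed.

Lemma strongly_monotone_le_lipschitz (m K : R) f : (0 < n)%N ->
  strongly_monotone_map m f -> lipschitz_map K f -> m <= K.
Proof.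
move=> n0 /(_ ones 0) mle /(_ ones 0) Kle.
have o0 := enorm_ones_gt0 n0.
rewrite -(ler_pM2r (exprn_gt0 2 o0)) (le_trans mle)//.
rewrite (le_trans (cauchy_schwarz _ _))// expr2 mulrA ler_wpM2r// ltW//.
Qed.

End lipschitz_constants.

Section rvc_ipg_rate.
Context {dT : measure_display} {Omega : measurableType dT} {R : realType}.
Variables (P : probability Omega R) (n d : nat).
Variables (X : set 'rV[R]_n) (G : 'rV[R]_n -> 'rV[R]_d -> 'rV[R]_n).
Variables (F Phi : 'rV[R]_n -> 'rV[R]_n) (L1 L2 mu : R) (x0 : 'rV[R]_n).
Variable xis : nat -> nat -> Omega -> 'rV[R]_d.
Variables (lambda eta theta : nat -> R) (N : nat -> nat).

Let x := rvc_ipg G X Phi lambda eta theta N x0 xis.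
Let err := sample_error G X Phi lambda eta theta N x0 xis F.

(** One iteration is a step for the regularized map, perturbed by the averaged
    sampling error. *)
Lemma rvc_ipgS k w : (0 < N k)%N ->
  x k.+1 w = x k w - theta k *:
    ipg_dir X (eta k) (regularized F Phi (lambda k) (x k w) + err k w) (x k w).
Proof.
move=> Nk; have -> : regularized F Phi (lambda k) (x k w) + err k w =
    Fhat G Phi lambda N xis k w (x k w); last by [].
rewrite /err /sample_error -/x sumrB sumr_const card_ord scalerBr.
rewrite -(scaler_nat (N k) (F (x k w))) scalerA mulVf ?pnatr_eq0 -?lt0n// scale1r.
by rewrite /Fhat /regularized; apply/rowP => i; rewrite !mxE; ring.
Qed.

Hypotheses (X0 : X !=set0) (Xcl : closed X) (Xconv : convex_set X).
Hypotheses (Fmono : monotone_map F) (Flip : lipschitz_map L1 F).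
Hypotheses (mu0 : 0 < mu) (Phimono : strongly_monotone_map mu Phi).
Hypothesis Philip : lipschitz_map L2 Phi.
Hypothesis sol : sivi_solutions X F !=set0.
Hypothesis noise : stochastic_error_assumption P G X Phi lambda eta theta N x0 xis F.
Hypothesis lambda_gt0 : forall k, 0 < lambda k.
Hypothesis lambda_sqr : forall k, lambda k ^+ 2 = isqrt k.
Hypothesis etaE : forall k, eta k = (L1 + L2) ^+ 2 / mu / lambda k.
Hypothesis thetaE : forall k, theta k = (8 * eta k)^-1.
Hypothesis N_ge : forall k, (k < N k)%N.

Let lambda_le1 k : lambda k <= 1.
Proof.
by rewrite -(@expr_le1 _ 2) ?(ltW (lambda_gt0 _))// lambda_sqr isqrt_le1.
Qed.

Let lambda_pow4 k : lambda k ^+ 4 = k.+1%:R^-1.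
Proof. by rewrite (exprM _ 2 2) lambda_sqr isqrt_sqr. Qed.

Let lambda_decr k : lambda k.+1 <= lambda k.
Proof.
rewrite -(@ler_pXn2r _ 4) ?nnegrE ?(ltW (lambda_gt0 _))// !lambda_pow4.
by rewrite lef_pV2 ?posrE ?ltr0n// ler_nat.
Qed.

(** Multiplied by [lambda k ^+ 3], the claim only involves fourth powers, since
    [lambda k.+1 <= lambda k]. *)
Let lambda_gap k : lambda k - lambda k.+1 <= lambda k ^+ 5.
Proof.
have l0 := lambda_gt0 k; have l1 := lambda_gt0 k.+1.
rewrite -(ler_pM2l (exprn_gt0 3 l0)) mulrBr -exprSr -exprD lerBlDr.
have pow_le : lambda k.+1 ^+ 4 <= lambda k ^+ 3 * lambda k.+1.
  rewrite exprSr ler_wpM2r ?(ltW l1)//.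
  by rewrite lerXn2r// nnegrE ltW.
rewrite -lerBlDl; apply: le_trans pow_le.
rewrite (exprM _ 4 2) !lambda_pow4.
have k1 : 0 < k.+1%:R :> R by rewrite ltr0n.
have k2 : 0 < k.+2%:R :> R by rewrite ltr0n.
have kS : k.+2%:R = k.+1%:R + 1 :> R by rewrite -natr1.
have -> : k.+1%:R^-1 - k.+1%:R^-1 ^+ 2 = (k.+1%:R - 1) / k.+1%:R ^+ 2 :> R.
  by field; rewrite gt_eqF.
rewrite ler_pdivrMr ?exprn_gt0// mulrC ler_pdivlMr// kS; lra.
Qed.

Lemma err_mean_le : exists2 K, 0 <= K & forall k,
  mean_le P (fun w => enorm (err k w) ^+ 2) (K * isqrt k ^+ 2).
Proof.
have [nu nu0 noisek] := noise; exists (nu ^+ 2); first exact: sqr_ge0.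
move=> k; have [_ [Y Ycond Yle]] := noisek k.
have nuN : nu ^+ 2 / (N k)%:R <= nu ^+ 2 * isqrt k ^+ 2.
  rewrite isqrt_sqr ler_wpM2l ?sqr_ge0// lef_pV2 ?posrE ?ltr0n//.
    by rewrite ler_nat N_ge.
  exact: leq_ltn_trans (N_ge k).
apply: condexp_mean_le Ycond _; first by rewrite mulr_ge0 ?sqr_ge0.
  by rewrite -setC0; apply: sigma_algebraC; exact: sigma_algebra0.
by apply: filterS Yle => w Yw; exact: le_trans Yw nuN.
Qed.

Lemma rvc_ipg_min_residual_rate : (0 < n)%N ->
  exists2 K, 0 < K & forall T : nat, (1 <= T)%N ->
    (min_residual P X F eta x T <= (K / Num.sqrt T%:R)%:E)%E.
Proof.
move=> n0.
have L1_ge0 := lipschitz_constant_ge0 n0 Flip.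
have muL2 := strongly_monotone_le_lipschitz n0 Phimono Philip.
have [xs xs_sol] := sol; have [K K0 s_mean] := err_mean_le.
pose M := 2 * ((L2 / mu) ^+ 2 + 1) * dot (Phi xs) (Phi xs).
have M0 : 0 <= M by rewrite mulr_ge0 ?dot_ge0// mulr_ge0// addr_ge0 ?sqr_ge0.
have /choice[p p_sol] : forall k, exists p,
    sivi_solutions X (regularized F Phi (lambda k)) p.
  move=> k; exact: (regularized_solution_exists X0 Xcl Xconv Fmono Flip mu0
    Phimono Philip L1_ge0 muL2 (lambda_gt0 k) (lambda_le1 k)).
have Phip k : dot (Phi (p k)) (Phi (p k)) <= M.
  exact: (dot_Phi_solution_le Fmono mu0 Phimono Philip xs_sol
    (lambda_gt0 k) (p_sol k)).
apply: (@min_mean_rate _ _ _ P (fun k w => dot (x k w - p k) (x k w - p k))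
  (fun k w => enorm (residual X F (x k w) (eta k)) ^+ 2)
  (fun k w => enorm (err k w) ^+ 2) (dot (x0 - p 0%N) (x0 - p 0%N))
  (residual_weight L1 L2 mu) (contraction_rate L1 L2 mu / 4)
  (error_const L1 L2 mu M) K) => //.
- by move=> k w; exact: dot_ge0.
- by move=> k w; exact: sqr_ge0.
- exact: residual_weight_gt0.
- by rewrite divr_gt0// contraction_rate_gt0.
- have := contraction_rate_le1 mu0 L1_ge0 muL2; lra.
- by apply/ltW/error_const_gt0.
- move=> k w; have Nk : (0 < N k)%N by exact: leq_ltn_trans (N_ge k).
  rewrite rvc_ipgS// thetaE -lambda_sqr [enorm (err k w) ^+ 2]enorm_sqr.
  by apply: (one_step X0 Xcl Xconv Fmono Flip mu0 Phimono Philip L1_ge0 muL2 M0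
    (lambda_gt0 k) (lambda_le1 k) (etaE k) (lambda_decr k) (lambda_gap k)
    (p_sol k) (p_sol k.+1) (Phip k) (Phip k.+1)).
Qed.

End rvc_ipg_rate.

(** * Oracle complexity *)

Section oracle_complexity.
Context {R : realType}.
Variable delta : R.
Hypothesis delta_gt0 : 0 < delta.

Definition batch_size (k : nat) : nat := absz (Num.ceil (k.+1%:R `^ (1 + delta) : R)).

Lemma batch_size_ceil k :
  (batch_size k)%:R = (Num.ceil (k.+1%:R `^ (1 + delta) : R))%:~R :> R.
Proof.
rewrite /batch_size -[LHS]/((absz (Num.ceil _))%:Z%:~R) gez0_abs//.
by rewrite ceil_ge0 (lt_le_trans _ (powR_ge0 _ _))// ltrN10.
Qed.

Lemma batch_size_gt k : (k < batch_size k)%N.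
Proof.
rewrite -(@ler_nat R) batch_size_ceil (le_trans _ (ceil_ge _))//.
by apply: le1r_powR; rewrite ?ler1n// lerDl ltW.
Qed.

Lemma batch_size_le (T k : nat) : (k < T)%N ->
  (batch_size k)%:R <= 2 * T%:R `^ (1 + delta) :> R.
Proof.
move=> kT; have T1 : 1 <= T%:R :> R by rewrite ler1n (leq_trans _ kT).
have kT' : k.+1%:R `^ (1 + delta) <= T%:R `^ (1 + delta) :> R.
  by apply: ge0_ler_powR; rewrite ?nnegrE ?ler0n ?ler_nat// addr_ge0// ltW.
have T1' : 1 <= T%:R `^ (1 + delta) :> R.
  by rewrite -[leLHS](powRr0 T%:R) ler_powR// addr_ge0// ltW.
have := ceilB1_lt (k.+1%:R `^ (1 + delta) : R).
by rewrite batch_size_ceil intrB; lra.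
Qed.

Lemma sum_batch_size_le (T : nat) : (0 < T)%N ->
  (\sum_(k < T) batch_size k)%N%:R <= 2 * T%:R `^ (2 + delta) :> R.
Proof.
move=> T0; rewrite natr_sum.
apply: (@le_trans _ _ (\sum_(k < T) 2 * T%:R `^ (1 + delta))).
  by apply: ler_sum => k _; exact: batch_size_le.
rewrite sumr_const card_ord -[leLHS]mulr_natr -mulrA ler_pM2l//.
have -> : 2 + delta = 1 + delta + 1 by ring.
rewrite [leRHS]powRD; last by rewrite pnatr_eq0 -lt0n T0 implybT.
by rewrite powRr1 ?ler0n.
Qed.

(** [T] is the least integer above [(K / eps) ^+ 2], so it is of order
    [eps ^- 2], and the calls are of order [T `^ (2 + delta)]. *)
Lemma oracle_calls_le (K : R) : 0 < K -> exists2 K', 0 < K' &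
  forall eps : R, 0 < eps -> eps <= 1 -> exists T : nat,
    [/\ (1 <= T)%N, K / Num.sqrt T%:R <= eps &
      (\sum_(k < T) batch_size k)%N%:R <= K' * eps `^ (- (4 + 2 * delta))].
Proof.
move=> K0; exists (2 * (K ^+ 2 + 1) `^ (2 + delta)).
  by rewrite mulr_gt0// powR_gt0// ltr_wpDl// sqr_ge0.
move=> eps eps0 eps1; pose q := (K / eps) ^+ 2.
have q0 : 0 <= q := sqr_ge0 _.
have K_eps : 0 < K / eps by rewrite divr_gt0.
exists (Num.truncn q).+1; set T := (Num.truncn q).+1.
have qT : q < T%:R := truncnS_gt q.
have Tq : T%:R <= q + 1 by rewrite -natr1 lerD2r truncn_le.
have T0 : 0 < T%:R :> R by rewrite ltr0n.
split => //.
  rewrite ler_pdivrMr ?sqrtr_gt0// mulrC -ler_pdivrMr//.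
  by rewrite -[leLHS]ger0_norm ?(ltW K_eps)// -sqrtr_sqr ler_sqrt ltW.
apply: le_trans (sum_batch_size_le _) _ => //; rewrite -mulrA ler_pM2l//.
have -> : - (4 + 2 * delta) = - 2 * (2 + delta) by ring.
rewrite (powRrM eps) -powRM ?powR_ge0 ?addr_ge0 ?sqr_ge0//.
apply: ge0_ler_powR; rewrite ?nnegrE.
- by rewrite addr_ge0// ltW.
- exact: ltW.
- by rewrite mulr_ge0 ?powR_ge0 ?addr_ge0 ?sqr_ge0.
apply: le_trans Tq _; rewrite (powR_invn 2 (ltW eps0)) mulrDl mul1r.
rewrite /q expr_div_n lerD2l invf_ge1 ?exprn_gt0// expr_le1//; exact: ltW.
Qed.

End oracle_complexity.

(** In dimension zero the constants [C1] and [C2] may vanish, but so does every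
    residual. *)
Lemma min_residual_dim0 {dT : measure_display} {Omega : measurableType dT}
    {R : realType} (P : probability Omega R) (X : set 'rV[R]_0)
    (F : 'rV[R]_0 -> 'rV[R]_0) (eta : nat -> R) (x : nat -> Omega -> 'rV[R]_0)
    (T : nat) : (1 <= T)%N -> (min_residual P X F eta x T <= 0)%E.
Proof.
move=> T1; apply: le_trans (bigmin_le_cond _ _ (isT : xpredT (Ordinal T1))) _.
have -> : (fun w => enorm (residual X F (x (Ordinal T1) w) (eta (Ordinal T1))) ^+ 2)
    = cst 0 by apply/funext => w; rewrite enorm_sqr /dot big_ord0.
by rewrite expectation_cst.
Qed.

Theorem corollary1 (R : realType) (dT : measure_display)
    (Omega : measurableType dT) (P : probability Omega R) (n d : nat)
    (X : set 'rV[R]_n)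
    (xi : {RV P >-> borel_rV R d})
    (G : 'rV[R]_n -> 'rV[R]_d -> 'rV[R]_n)
    (Phi : 'rV[R]_n -> 'rV[R]_n)
    (L1 L2 mu delta : R) (x0 : 'rV[R]_n)
    (xis : nat -> nat -> {RV P >-> borel_rV R d}) :
  let F := mean_map P G xi in
  let C1 : R := (L1 + L2) ^+ 2 / mu in
  let C2 : R := 1 / (8 * C1) in
  let lambda (k : nat) : R := k.+1%:R `^ (- (1 / 4)) in
  let eta (k : nat) : R := C1 * k.+1%:R `^ (1 / 4) in
  let theta (k : nat) : R := C2 * k.+1%:R `^ (- (1 / 4)) in
  let N (k : nat) : nat := absz (Num.ceil (k.+1%:R `^ (1 + delta) : R)) in
  let x := rvc_ipg G X Phi lambda eta theta N x0 xis in
  X !=set0 -> closed X -> convex_set X ->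
  measurable_fun [set: borel_rV R n * borel_rV R d]
    (fun p => G p.1 p.2 : borel_rV R n) ->
  (forall (y : 'rV[R]_n) (i : 'I_n),
     P.-integrable setT (fun w => (G y (xi w) 0 i)%:E)) ->
  (forall (j k : nat), (j < N k)%N ->
     forall A : set (borel_rV R d), measurable A ->
       distribution P (xis j k) A = distribution P xi A) ->
  0 < delta ->
  monotone_map F -> lipschitz_map L1 F ->
  0 < mu -> strongly_monotone_map mu Phi -> lipschitz_map L2 Phi ->
  sivi_solutions X F !=set0 ->
  stochastic_error_assumption P G X Phi lambda eta theta N x0 xis F ->
  (exists2 K : R, 0 < K &
     forall T : nat, (1 <= T)%N ->
       (min_residual P X F eta x T <= (K / Num.sqrt T%:R)%:E)%E) /\
  (exists2 K' : R, 0 < K' &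
     forall eps : R, 0 < eps -> eps <= 1 ->
       exists T : nat, [/\ (1 <= T)%N,
         (min_residual P X F eta x T <= eps%:E)%E &
         ((\sum_(k < T) N k)%N%:R : R) <= K' * eps `^ (- (4 + 2 * delta))]).

Proof.
move=> F C1 C2 lambda eta theta N x X0 Xcl Xconv _ _ _ delta0 Fmono Flip mu0
  Phimono Philip sol noise.
have rate : exists2 K : R, 0 < K & forall T : nat, (1 <= T)%N ->
    (min_residual P X F eta x T <= (K / Num.sqrt T%:R)%:E)%E.
  case: n => [|n'] in X G Phi x0 F x X0 Xcl Xconv Fmono Flip Phimono Philip sol noise *.
    exists 1 => // T T1; apply: le_trans (min_residual_dim0 _ _ _ _ _ T1) _.
    by rewrite lee_fin divr_ge0// sqrtr_ge0.
  have k0 k : 0 <= k.+1%:R :> R by rewrite ler0n.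
  apply: (@rvc_ipg_min_residual_rate _ _ _ P n'.+1 d X G F Phi L1 L2 mu x0) => //.
  - by move=> k; rewrite powR_gt0.
  - move=> k; rewrite -powR_mulrn ?powR_ge0// -powRrM /isqrt -powR12_sqrt//.
    by rewrite -powRN; congr (_ `^ _); field.
  - by move=> k; rewrite /eta /lambda powRN invrK.
  - move=> k; rewrite /theta /C2 /eta powRN div1r !invfM.
    by rewrite !mulrA.
  - by move=> k; exact: batch_size_gt.
split=> //; have [K K0 Kle] := rate.
have [K' K'0 calls] := oracle_calls_le delta0 K0; exists K' => // eps eps0 eps1.
have [T [T1 Teps sumT]] := calls eps eps0 eps1; exists T; split => //.
by apply: le_trans (Kle T T1) _; rewrite lee_fin.
Qed.
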